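(* Let $I\subset\mathbb{R}$ be a nondegenerate interval, let $\omega=(\omega_1,\omega_2):I\to\mathbb{R}^2$ be a $2$-dimensional positive Chebyshev system over $I$, and let $\omega_3:I\to\mathbb{R}$ be such that $\omega^*=(\omega_1,\omega_2,\omega_3)$ is a $3$-dimensional positive Chebyshev system over $I$. Let $(t_1,t_2)\in\mathbb{R}_+^2$ and $f:I\to\mathbb{R}$. Then, for every $(x,y)\in\sigma_2(I)$, there exists $p\in[x,y]$ such that $$\big[x,\tfrac{t_2}{t_1+t_2}x+\tfrac{t_1}{t_1+t_2}y,y;f\big]_{\omega^*}\ge\min\big\{\underline{D}_{\,((t_1,t_2),\omega^* )}f(p),\ \underline{D}_{\,((t_2,t_1),\omega^* )}f(p)\big\}.$$
   Context: $\mathbb{R}_+$ is the set of positive reals. $\sigma_k(I):=\{(x_1,\dots,x_k)\in I^k\mid x_1<\dots<x_k\}$. For $\omega=(\omega_1,\dots,\omega_k):I\to\mathbb{R}^k$ and $(x_1,\dots,x_k)\in\sigma_k(I)$, $\Phi_\omega(x_1,\dots,x_k):=\det\big(\omega_i(x_j)\big)_{i,j=1}^k$. $\omega$ is a $k$-dimensional positive Chebyshev system over $I$ if $\Phi_\omega>0$ on $\sigma_k(I)$. For $\omega=(\omega_1,\omega_2)$ and $f:I\to\mathbb{R}$, $(\omega,f):=(\omega_1,\omega_2,f)$, and $$[x_0,x_1,x_2;f]_{\omega^*}:=\frac{\Phi_{(\omega,f)}(x_0,x_1,x_2)}{\Phi_{\omega^*}(x_0,x_1,x_2)}\qquad\text{for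 }(x_0,x_1,x_2)\in\sigma_3(I).$$ For $(s_1,s_2)\in\mathbb{R}_+^2$ and $p\in I$, the lower Dinghas type derivative (an extended real number) is $$\underline{D}_{\,((s_1,s_2),\omega^* )}f(p):=\lim_{\delta\to0^+}\inf\Big\{\big[x,\tfrac{s_2}{s_1+s_2}x+\tfrac{s_1}{s_1+s_2}y,y;f\big]_{\omega^*}: (x,y)\in\sigma_2(I),\ x\le p\le y,\ y-x<\delta\Big\}.$$ *)

(* Defs.v *)
From HB Require Import structures.
From mathcomp Require Import all_boot all_order all_algebra.
From mathcomp Require Import all_classical all_reals all_analysis.

Set Implicit Arguments.
Unset Strict Implicit.
Unset Printing Implicit Defensive.

Import Order.TTheory GRing.Theory Num.Theory.
Import numFieldNormedType.Exports.

Local Open Scope classical_set_scope.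
Local Open Scope ring_scope.

Definition nondegenerate_interval (R : realType) (I : set R) : Prop :=
  is_interval I /\ exists a b : R, [/\ I a, I b & a < b].

Definition simplex (R : realType) (k : nat) (I : set R) : set (k.-tuple R) :=
  [set x | (forall i : 'I_k, I (tnth x i)) /\
           (forall i j : 'I_k, (i < j)%N -> tnth x i < tnth x j)].

(* Functions on I are represented by total functions R -> R; only their values
   on I are ever used. *)
Definition Phi (R : realType) (k : nat) (w : k.-tuple (R -> R))
    (x : k.-tuple R) : R :=
  \det (\matrix_(i < k, j < k) tnth w i (tnth x j)).

Definition positive_Chebyshev_system (R : realType) (k : nat) (I : set R)
    (w : k.-tuple (R -> R)) : Prop :=
  forall x : k.-tuple R, simplex I x -> 0 < Phi w x.

Definition gdivdiff (R : realType) (w1 w2 w3 : R -> R) (x0 x1 x2 : R)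
    (f : R -> R) : R :=
  Phi [tuple w1; w2; f] [tuple x0; x1; x2] /
  Phi [tuple w1; w2; w3] [tuple x0; x1; x2].

(* The weight of x is s2 and that of y is s1, so that the result u satisfies
   (u - x) : (y - u) = s1 : s2. *)
Definition wmean (R : realType) (s1 s2 x y : R) : R :=
  s2 / (s1 + s2) * x + s1 / (s1 + s2) * y.

(* The limit always exists in \bar R, the infimum being monotone in delta. *)
Definition lower_Dinghas (R : realType) (I : set R) (s1 s2 : R)
    (w1 w2 w3 f : R -> R) (p : R) : \bar R :=
  lim (ereal_inf
         [set (gdivdiff w1 w2 w3 xy.1 (wmean s1 s2 xy.1 xy.2) xy.2 f)%:E |
            xy in [set xy : R * R |
                     [/\ simplex I [tuple xy.1; xy.2],
                         xy.1 <= p <= xy.2 & xy.2 - xy.1 < delta]]]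
       @[delta --> 0^'+]).

(* Main.v *)
(* Put t = s1 / (s1 + s2) and split x < u < y, where u - x = t (y - x), further
   by v and w into lengths proportional to t^2, t (1 - t), (1 - t)^2, t (1 - t).
   Then x < v < u and v < u < w are again divided in the ratio s1 : s2, and
   u < w < y in the ratio s2 : s1. Positivity of determinants of (w1, w2, g) on
   consecutive triples propagates to the outer triple; applied to
   g = f - A w3 this shows that if the divided difference at (x, u, y) is at
   most A, so is the one of some consecutive triple, in an interval shorter by
   the factor max t (1 - t) < 1. Iterating, the nested intervals shrink to a
   point p, and one of the two orders of the weights occurs at every scale. *)

Require Import Defs.
From mathcomp Require Import all_boot all_order all_algebra.
From mathcomp Require Import all_classical all_reals all_analysis.
From mathcomp Require Import ring lra.

Set Implicit Arguments.
Unset Strict Implicit.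

Import Order.TTheory GRing.Theory Num.Theory.
Import numFieldNormedType.Exports.

Local Open Scope classical_set_scope.
Local Open Scope ring_scope.

(** * Determinants of orders two and three *)

Lemma Phi2E (R : realType) (w1 w2 : R -> R) (a b : R) :
  Phi [tuple w1; w2] [tuple a; b] = w1 a * w2 b - w1 b * w2 a.
Proof.
rewrite /Phi (expand_det_row _ ord0) !big_ord_recl big_ord0 /cofactor !det_mx11.
by rewrite !mxE /= !(tnth_nth w1) !(tnth_nth a) /=; ring.
Qed.

(** Expansion along the last row: the determinant is linear in [g], and its coefficients are, up to
    sign, the 2 by 2 minors that the Chebyshev hypothesis makes positive. *)
Lemma Phi3E (R : realType) (w1 w2 g : R -> R) (a b c : R) :
  Phi [tuple w1; w2; g] [tuple a; b; c] =
  Phi [tuple w1; w2] [tuple b; c] * g a - Phi [tuple w1; w2] [tuple a; c] * g b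
  + Phi [tuple w1; w2] [tuple a; b] * g c.
Proof.
rewrite !Phi2E /Phi (expand_det_row _ ord0) !big_ord_recl big_ord0 /cofactor.
rewrite !(expand_det_row _ ord0) !big_ord_recl !big_ord0 /cofactor !det_mx11.
by rewrite !mxE /= !(tnth_nth w1) !(tnth_nth a) /=; ring.
Qed.

Lemma simplex2 (R : realType) (I : set R) (a b : R) :
  I a -> I b -> a < b -> simplex I [tuple a; b].
Proof. by move=> Ia Ib ab; split=> [[[|[|i]] hi]|[[|[|i]] hi] [[|[|j]] hj]]. Qed.

Lemma simplex3 (R : realType) (I : set R) (a b c : R) :
  I a -> I b -> I c -> a < b -> b < c -> simplex I [tuple a; b; c].
Proof.
move=> Ia Ib Ic ab bc.
split=> [[[|[|[|i]]] hi]|[[|[|[|i]]] hi] [[|[|[|j]]] hj]] //= _.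
exact: lt_trans bc.
Qed.

(** * Propagation of signs between point triples *)

Section convexity.
Context (R : realType) (I : set R) (w1 w2 : R -> R).
Hypothesis w_gt0 : positive_Chebyshev_system I [tuple w1; w2].

Lemma Phi_gt0_left (g : R -> R) (a b c e : R) :
  I a -> I b -> I c -> I e -> a < b -> b < c -> c < e ->
  0 < Phi [tuple w1; w2; g] [tuple a; b; c] ->
  0 < Phi [tuple w1; w2; g] [tuple b; c; e] ->
  0 < Phi [tuple w1; w2; g] [tuple a; b; e].
Proof.
move=> Ia Ib Ic Ie ab bc ce h1 h2.
have dab := w_gt0 (simplex2 Ia Ib ab).
have dbc := w_gt0 (simplex2 Ib Ic bc).
have dbe := w_gt0 (simplex2 Ib Ie (lt_trans bc ce)).
rewrite -(pmulr_lgt0 _ dbc).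
(* Three-term Plücker relation. *)
suff -> : Phi [tuple w1; w2; g] [tuple a; b; e] * Phi [tuple w1; w2] [tuple b; c]
  = Phi [tuple w1; w2; g] [tuple a; b; c] * Phi [tuple w1; w2] [tuple b; e]
  + Phi [tuple w1; w2; g] [tuple b; c; e] * Phi [tuple w1; w2] [tuple a; b].
  by rewrite addr_gt0 // mulr_gt0.
by rewrite !Phi3E !Phi2E; ring.
Qed.

Lemma Phi_gt0_right (g : R -> R) (a b c e : R) :
  I a -> I b -> I c -> I e -> a < b -> b < c -> c < e ->
  0 < Phi [tuple w1; w2; g] [tuple a; b; c] ->
  0 < Phi [tuple w1; w2; g] [tuple b; c; e] ->
  0 < Phi [tuple w1; w2; g] [tuple a; c; e].
Proof.
move=> Ia Ib Ic Ie ab bc ce h1 h2.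
have dac := w_gt0 (simplex2 Ia Ic (lt_trans ab bc)).
have dbc := w_gt0 (simplex2 Ib Ic bc).
have dce := w_gt0 (simplex2 Ic Ie ce).
rewrite -(pmulr_lgt0 _ dbc).
(* The companion relation, which drops [b] instead of [c]; the weights are again positive minors. *)
suff -> : Phi [tuple w1; w2; g] [tuple a; c; e] * Phi [tuple w1; w2] [tuple b; c]
  = Phi [tuple w1; w2; g] [tuple a; b; c] * Phi [tuple w1; w2] [tuple c; e]
  + Phi [tuple w1; w2; g] [tuple b; c; e] * Phi [tuple w1; w2] [tuple a; c].
  by rewrite addr_gt0 // mulr_gt0.
by rewrite !Phi3E !Phi2E; ring.
Qed.

End convexity.

(** * Subdivision of divided differences *)

(** Clearing the positive denominator and using linearity in the last row absorbs the bound [A] into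
    the third function. *)
Lemma gdivdiff_gtE (R : realType) (I : set R) (w1 w2 w3 f : R -> R)
    (A a b c : R) :
  positive_Chebyshev_system I [tuple w1; w2; w3] ->
  I a -> I b -> I c -> a < b -> b < c ->
  (A < gdivdiff w1 w2 w3 a b c f) =
  (0 < Phi [tuple w1; w2; fun z => f z - A * w3 z] [tuple a; b; c]).
Proof.
move=> ws_gt0 Ia Ib Ic ab bc.
rewrite /gdivdiff ltr_pdivlMr; last exact: ws_gt0 (simplex3 Ia Ib Ic ab bc).
rewrite -subr_gt0; congr (0 < _); rewrite !Phi3E; ring.
Qed.

Lemma gdivdiff_split (R : realType) (I : set R) (w1 w2 w3 f : R -> R)
    (A x v u w y : R) :
  is_interval I ->
  positive_Chebyshev_system I [tuple w1; w2] ->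
  positive_Chebyshev_system I [tuple w1; w2; w3] ->
  I x -> I y -> x < v -> v < u -> u < w -> w < y ->
  gdivdiff w1 w2 w3 x u y f <= A ->
  [\/ gdivdiff w1 w2 w3 x v u f <= A, gdivdiff w1 w2 w3 v u w f <= A |
      gdivdiff w1 w2 w3 u w y f <= A].
Proof.
move=> Iitv w_gt0 ws_gt0 Ix Iy xv vu uw wy.
have Iin z : x < z -> z < y -> I z.
  by move=> xz zy; apply: (Iitv x y) => //; rewrite !ltW.
have xu := lt_trans xv vu; have uy := lt_trans uw wy.
have Iv := Iin _ xv (lt_trans vu uy).
have Iu := Iin _ xu uy.
have Iw := Iin _ (lt_trans xu uw) wy.
have [h1|h1 h] := leP (gdivdiff w1 w2 w3 x v u f) A; first by constructor 1.
have [h2|h2] := leP (gdivdiff w1 w2 w3 v u w f) A; first by constructor 2.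
have [h3|h3] := leP (gdivdiff w1 w2 w3 u w y f) A; first by constructor 3.
move: h1 h2 h3 h; rewrite leNgt !(gdivdiff_gtE _ _ ws_gt0) //.
(* By contraposition: the triples (x, v, u) and (v, u, w) give positivity at (x, u, w), and this
   with (u, w, y) gives it at (x, u, y). *)
move=> h1 h2 h3 /negP[]; apply: (Phi_gt0_left w_gt0 _ _ Iw) => //.
exact: (Phi_gt0_right w_gt0 _ Iv).
Qed.

(** Both orders of the weights occur in the conclusion because the last of the three pieces is
    divided in the reversed ratio. *)
Lemma trisection (R : realType) (I : set R) (w1 w2 w3 f : R -> R)
    (A s1 s2 x y : R) :
  is_interval I ->
  positive_Chebyshev_system I [tuple w1; w2] ->
  positive_Chebyshev_system I [tuple w1; w2; w3] ->
  0 < s1 -> 0 < s2 -> I x -> I y -> x < y ->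
  gdivdiff w1 w2 w3 x (wmean s1 s2 x y) y f <= A ->
  exists a b : R, [/\ x <= a, a < b, b <= y,
    b - a <= Num.max s1 s2 / (s1 + s2) * (y - x) &
    gdivdiff w1 w2 w3 a (wmean s1 s2 a b) b f <= A \/
    gdivdiff w1 w2 w3 a (wmean s2 s1 a b) b f <= A].
Proof.
move=> Iitv w_gt0 ws_gt0 s1_gt0 s2_gt0 Ix Iy xy.
set t := s1 / (s1 + s2).
have s_neq0 : s1 + s2 != 0 by rewrite gt_eqF// addr_gt0.
have t_gt0 : 0 < t by rewrite divr_gt0// addr_gt0.
have tE : s2 / (s1 + s2) = 1 - t by rewrite /t; field.
have t_lt1 : 0 < 1 - t by rewrite -tE divr_gt0// addr_gt0.
have wm12 a b : wmean s1 s2 a b = a + t * (b - a) by rewrite /wmean tE -/t; ring.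
have wm21 a b : wmean s2 s1 a b = a + (1 - t) * (b - a).
  by rewrite /wmean (addrC s2) tE -/t; ring.
have qt : t <= Num.max s1 s2 / (s1 + s2).
  by rewrite ler_pM2r ?invr_gt0 ?addr_gt0// le_max lexx.
have q1t : 1 - t <= Num.max s1 s2 / (s1 + s2).
  by rewrite -tE ler_pM2r ?invr_gt0 ?addr_gt0// le_max lexx orbT.
set q := _ / _ in qt q1t *.
have d_gt0 : 0 < y - x by rewrite subr_gt0.
set d := y - x in d_gt0 *; have yE : y = x + d by rewrite /d; ring.
(* The nonlinear products are bounded beforehand, so that only linear goals remain for [lra]. *)
have td : 0 < t * d by rewrite mulr_gt0.
have t'd : 0 < (1 - t) * d by rewrite mulr_gt0.
have ttd : 0 < t * (t * d) by rewrite mulr_gt0.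
have t'td : 0 < (1 - t) * (t * d) by rewrite mulr_gt0.
have t't'd : 0 < (1 - t) * ((1 - t) * d) by rewrite mulr_gt0.
have qtd : t * d <= q * d by rewrite ler_pM2r.
have qt'd : (1 - t) * d <= q * d by rewrite ler_pM2r.
pose u := wmean s1 s2 x y; pose v := wmean s1 s2 x u; pose w := wmean s2 s1 u y.
have uE : u = x + t * d by rewrite /u wm12.
have vE : v = x + t * (t * d) by rewrite /v wm12 uE; ring.
have wE : w = u + (1 - t) * ((1 - t) * d) by rewrite /w wm21 yE uE; ring.
(* Here w - v = (1 - t) d and u - v = t (1 - t) d. *)
have mid : u = wmean s1 s2 v w by rewrite wm12 wE vE uE; ring.
move=> /(@gdivdiff_split _ _ _ _ _ _ _ _ v u w y Iitv w_gt0 ws_gt0 Ix Iy).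
case; [lra..|move=> h|move=> h|move=> h].
- by exists x, u; split; [lra..|left].
- by exists v, w; split; [lra..|left; rewrite -mid].
- by exists u, y; split; [lra..|right].
Qed.

(** * Nested intervals and the lower derivative *)

Lemma nested_intervals (R : realType) (P : R -> R -> Prop) (q x y : R) :
  0 <= q < 1 -> x <= y -> P x y ->
  (forall a b, a <= b -> P a b -> exists c d : R,
    [/\ a <= c, c <= d, d <= b, d - c <= q * (b - a) & P c d]) ->
  exists p : R, x <= p <= y /\ forall e, 0 < e ->
    exists a b : R, [/\ a <= p <= b, b - a < e & P a b].
Proof.
move=> /andP[q_ge0 q_lt1] xy Pxy step.
(* The hypotheses on [z] sit inside the relation to make it total, as [choice] demands; where they
   fail, any value will do, and [z] itself is taken. *)
pose refines (z z' : R * R) := z.1 <= z.2 -> P z.1 z.2 ->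
  [/\ z.1 <= z'.1, z'.1 <= z'.2, z'.2 <= z.2,
      z'.2 - z'.1 <= q * (z.2 - z.1) & P z'.1 z'.2].
have [|F HF] := @choice _ _ refines.
  move=> [a b]; rewrite /refines /=.
  have [[ab Pab]|N] := pselect (a <= b /\ P a b); last first.
    by exists (a, b) => ab Pab; case: N.
  by have [c [d [? ? ? ? ?]]] := step _ _ ab Pab; exists (c, d).
pose z n := iter n F (x, y).
have zP n : (z n).1 <= (z n).2 /\ P (z n).1 (z n).2.
  by elim: n => [//|n [h1 h2]]; have [] := HF _ h1 h2.
have zS n := let: conj h1 h2 := zP n in HF _ h1 h2.
have lb_homo : {homo (fun n => (z n).1) : m n / (m <= n)%N >-> m <= n}.
  by apply: homo_leq => // [? ? ?|n]; [exact: le_trans|have [] := zS n].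
have ub_homo m n : (m <= n)%N -> (z n).2 <= (z m).2.
  move=> mn; rewrite -lerN2; move: m n mn.
  apply: (homo_leq (f := fun n => - (z n).2) (r := <=%R)) => // [? ? ?|n].
    exact: le_trans.
  by rewrite lerN2; have [] := zS n.
have lt_ub m n : (z m).1 <= (z n).2.
  have [mn|/ltnW nm] := leqP m n.
    by apply: le_trans (lb_homo _ _ mn) _; case: (zP n).
  by apply: le_trans (ub_homo _ _ nm); case: (zP m).
have size n : (z n).2 - (z n).1 <= q ^+ n * (y - x).
  elim: n => [|n IHn]; first by rewrite mul1r.
  have [_ _ _ + _] := zS n; move=> /le_trans; apply.
  by rewrite exprS -mulrA ler_wpM2l.
(* Every right endpoint bounds every left endpoint, so the supremum of the left endpoints lies in
   all the intervals. *)
pose E := range (fun n => (z n).1).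
have E0 : E !=set0 by exists (z 0%N).1, 0%N.
have Eub n : ubound E (z n).2 by move=> _ [m _ <-].
have pin n : (z n).1 <= sup E <= (z n).2.
  apply/andP; split; last exact: ge_sup.
  by apply: ub_le_sup; [exists (z 0%N).2|exists n].
exists (sup E); split; first exact: (pin 0%N).
move=> e e_gt0.
have : (fun n => q ^+ n * (y - x)) @ \oo --> (0 : R).
  rewrite -(mul0r (y - x)); apply: cvgM; last exact: cvg_cst.
  by apply: cvg_expr; rewrite ger0_norm.
move=> /cvgrPdist_lt /(_ e e_gt0) [N _ /(_ N (leqnn N))] /=.
rewrite sub0r normrN => /(le_lt_trans (ler_norm _)) qN.
exists (z N).1, (z N).2; split; [exact: pin| |by case: (zP N)].
exact: le_lt_trans (size N) qN.
Qed.

Lemma lower_Dinghas_le (R : realType) (I : set R) (s1 s2 : R)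
    (w1 w2 w3 f : R -> R) (p A : R) :
  (forall e, 0 < e -> exists a b : R,
    [/\ simplex I [tuple a; b], a <= p <= b, b - a < e &
        gdivdiff w1 w2 w3 a (wmean s1 s2 a b) b f <= A]) ->
  (lower_Dinghas I s1 s2 w1 w2 w3 f p <= A%:E)%E.
Proof.
move=> h; apply: lime_le.
  (* A larger [delta] admits more pairs, so the infimum is nonincreasing in [delta] and its right
     limit at 0 exists. *)
  apply: nonincreasing_at_right_is_cvge; near=> d => e1 e2 _ _ e12.
  apply: ereal_inf_le_tmp => _ [[a b] /= [sab pab ab] <-].
  by exists (a, b) => //; split => //; exact: lt_le_trans e12.
near=> e; have e_gt0 : 0 < e by near: e; exact: nbhs_right_gt.
have [a [b [sab pab ab le_A]]] := h e e_gt0.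
apply: ge_ereal_inf; exists (gdivdiff w1 w2 w3 a (wmean s1 s2 a b) b f)%:E => //.
by exists (a, b).
Unshelve. all: by end_near. Qed.

(** * The mean value inequality *)

Unset Implicit Arguments.
Set Strict Implicit.

Theorem theorem16 (R : realType) (I : set R) (w1 w2 w3 : R -> R)
    (t1 t2 : R) (f : R -> R) :
  nondegenerate_interval I ->
  positive_Chebyshev_system I [tuple w1; w2] ->
  positive_Chebyshev_system I [tuple w1; w2; w3] ->
  0 < t1 -> 0 < t2 ->
  forall x y : R, simplex I [tuple x; y] ->
  exists p : R, x <= p <= y /\
    ((gdivdiff w1 w2 w3 x (wmean t1 t2 x y) y f)%:E >=
     Order.min (lower_Dinghas I t1 t2 w1 w2 w3 f p)
               (lower_Dinghas I t2 t1 w1 w2 w3 f p))%E.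
Proof.
move=> [Iitv _] w_gt0 ws_gt0 t1_gt0 t2_gt0 x y [Ixy ltxy].
have Ix : I x := Ixy ord0; have Iy : I y := Ixy (lift ord0 ord0).
have xy : x < y := ltxy ord0 (lift ord0 ord0) isT.
set A := gdivdiff _ _ _ _ _ _ _.
pose B s1 s2 a b := gdivdiff w1 w2 w3 a (wmean s1 s2 a b) b f <= A.
(* The order of the weights is left open, since each subdivision may reverse it. *)
pose P a b := [/\ I a, I b, a < b & B t1 t2 a b \/ B t2 t1 a b].
pose q := Num.max t1 t2 / (t1 + t2).
have q01 : 0 <= q < 1.
  rewrite /q divr_ge0 ?le_max ?ltW ?addr_gt0//=.
  by rewrite ltr_pdivrMr ?addr_gt0// mul1r gt_max ltrDl ltrDr t1_gt0 t2_gt0.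
have step a b : a <= b -> P a b -> exists c d : R,
    [/\ a <= c, c <= d, d <= b, d - c <= q * (b - a) & P c d].
  move=> _ [Ia Ib ab Bab].
  have [c [d [ac cd db dc Bcd]]] : exists c d : R,
      [/\ a <= c, c < d, d <= b, d - c <= q * (b - a) &
          B t1 t2 c d \/ B t2 t1 c d].
    case: Bab => Bab.
      exact: (trisection Iitv w_gt0 ws_gt0 t1_gt0 t2_gt0 Ia Ib ab Bab).
    (* For the reversed order the weights are exchanged; the factor [q] is symmetric in them. *)
    have [c [d [ac cd db dc Bcd]]] :=
      trisection Iitv w_gt0 ws_gt0 t2_gt0 t1_gt0 Ia Ib ab Bab.
    exists c, d; split=> //; last by case: Bcd; [right|left].
    by rewrite /q maxC (addrC t1).
  have [ad cb] := (le_trans ac (ltW cd), le_trans (ltW cd) db).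
  exists c, d; split=> //; first exact: ltW.
  by split=> //; apply: (Iitv a b) => //; apply/andP.
have Pxy : P x y by split=> //; left; exact: lexx.
have [p [pxy pP]] := nested_intervals q01 (ltW xy) Pxy step.
exists p; split=> //.
pose Q s1 s2 e := exists a b : R,
  [/\ simplex I [tuple a; b], a <= p <= b, b - a < e & B s1 s2 a b].
(* Either the order [t1], [t2] occurs at every scale, or it is absent below some [e1]. In the latter
   case the intervals shorter than both [e1] and [e] must carry the other order. *)
have [h|/existsNP[e1 /not_implyP[e1_gt0 N1]]] :=
    pselect (forall e, 0 < e -> Q t1 t2 e).
  by rewrite ge_min lower_Dinghas_le.
rewrite ge_min [X in _ || X]lower_Dinghas_le ?orbT// => e e_gt0.
have [|a [b [pab ab [Ia Ib lt_ab Bab]]]] := pP (Num.min e1 e).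
  by rewrite lt_min e1_gt0.
move: ab; rewrite lt_min => /andP[abe1 abe].
have sab := simplex2 Ia Ib lt_ab.
case: Bab => Bab; last by exists a, b.
by case: N1; exists a, b.
Qed.
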